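(* There exist Synchronous Strict PIP algorithms for the parallel packing problem and for the parallel partition problem.
   Context: PRAM model: synchronous processors with a shared memory, each processor also having its own private memory, measured in words. Span is the maximum number of operations performed by a single processor. Synchronous Strict PIP (parallel in-place): let $1\le p\le n$ be the number of processors available, where $n$ is the input size. A PRAM algorithm is Synchronous Strict PIP if it (1) allocates no shared memory aside from the input, (2) uses $\Theta(1)$ private memory per processor, (3) has $O((n/p)\,\mathrm{polylog}(n))$ span, and (4) uses at most $\Theta(1)$ additional space, i.e. is strictly in-place, when run sequentially. Packing problem: given an array of length $n$ in shared memory containing $0$'s and $1$'s in any order (the entries may be elements labelled $0$ or $1$), rearrange the array so that all the $1$'s appear at the beginning of the array, followed by all the $0$'s. Partition problem: given an array of $n$ elements of a totally ordered set and a pivot $q$, which is initially the last element of the array, rearrange the array so that all elements less than $q$ are to the left of $q$ and all (other) elements greater than or equal to $q$ are to its right. *)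

(* Defs.v *)
From mathcomp Require Import all_boot all_order.

Set Implicit Arguments.
Unset Strict Implicit.
Unset Printing Implicit Defensive.

(* Programs.  A program is one fixed finite text, independent of the input
   size, of the number of processors and of the type of the elements; every
   processor runs the same text.  All operands named d, s, a, b below are
   addresses in the private memory of the executing processor. *)

Inductive immediate :=
  | Literal of nat
  | InputSize
  | NumProcs
  | ProcId.

Inductive binop := Add | Sub | Mul | Div | Mod | Eq | Lt.

Inductive instr :=
  | Set_ (d : nat) (v : immediate)
  | Move (d s : nat)
  | Arith (o : binop) (d a b : nat)
  | Compare (d a b : nat)   (* the only operation that inspects elements *)
  | GetPriv (d a : nat)     (* priv[d] := priv[priv[a]] *)
  | PutPriv (a s : nat)     (* priv[priv[a]] := priv[s] *)
  | Read (d a : nat)        (* priv[d] := shared[priv[a]] *)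
  | Write (a s : nat).      (* shared[priv[a]] := priv[s] *)

(* There are no procedures, so the control state below (what remains to be
   executed) ranges over a finite set determined by the program text. *)
Inductive stmt :=
  | Op of instr
  | If of nat & seq stmt & seq stmt
  | While of nat & seq stmt.

Definition program := seq stmt.

(* A word is either one array element, which is opaque, or a number. *)
Inductive word (T : Type) := Elt of T | Num of nat.
Arguments Num {T}.

Definition num_of (T : Type) (w : word T) : option nat :=
  if w is Num v then Some v else None.

Definition elt_of (T : Type) (w : word T) : option T :=
  if w is Elt x then Some x else None.

Definition fits (T : Type) (wmax : nat) (w : word T) : bool :=
  if w is Num v then v < wmax else true.

Definition memory (T : Type) := nat -> word T.

Definition upd (T : Type) (m : memory T) (d : nat) (w : word T) : memory T :=
  fun x => if x == d then w else m x.

(* Subtraction is truncated; division and remainder by 0 follow ssrnat. *)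
Definition eval_binop (o : binop) (x y : nat) : nat :=
  match o with
  | Add => x + y
  | Sub => x - y
  | Mul => x * y
  | Div => x %/ y
  | Mod => x %% y
  | Eq => x == y
  | Lt => x < y
  end.

Record params := Params {
  size_in : nat;        (* input size *)
  procs : nat;          (* number of processors *)
  shared_words : nat;   (* number of words of shared memory, input included *)
  priv_words : nat;     (* number of words of private memory per processor *)
  word_max : nat        (* numbers held in a word are < word_max *)
}.

Record local (T : Type) := Local { control : program; priv : memory T }.

Record config (g : params) (T : Type) :=
  Config { shared : memory T; proc : 'I_(procs g) -> local T }.

(* None: no access; Some (x, None): read of cell x;
   Some (x, Some w): write of w in cell x. *)
Definition access (T : Type) := option (nat * option (word T)).

Section Semantics.

Variables (g : params) (T : Type) (test : T -> T -> bool).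

Definition fetch (m : memory T) (a : nat) : option (word T) :=
  if a < priv_words g then Some (m a) else None.

Definition fetch_num (m : memory T) (a : nat) : option nat :=
  obind (@num_of T) (fetch m a).

Definition fetch_elt (m : memory T) (a : nat) : option T :=
  obind (@elt_of T) (fetch m a).

Definition store (m : memory T) (d : nat) (w : word T) : option (memory T) :=
  if (d < priv_words g) && fits (word_max g) w then Some (upd m d w) else None.

Definition immediate_val (id : nat) (v : immediate) : nat :=
  match v with
  | Literal x => x
  | InputSize => size_in g
  | NumProcs => procs g
  | ProcId => id
  end.

(* None is a fault: address out of the memory, number too large for a word,
   or operand of the wrong kind. *)
Definition exec_instr (id : nat) (sh m : memory T) (i : instr) :
    option (memory T * access T) :=
  let quiet (om : option (memory T)) :=
    omap (fun m' => (m', None : access T)) om in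
  match i with
  | Set_ d v => quiet (store m d (Num (immediate_val id v)))
  | Move d s => quiet (obind (store m d) (fetch m s))
  | Arith o d a b =>
      quiet (obind (fun x => obind (fun y =>
        store m d (Num (eval_binop o x y))) (fetch_num m b)) (fetch_num m a))
  | Compare d a b =>
      quiet (obind (fun x => obind (fun y =>
        store m d (Num (test x y))) (fetch_elt m b)) (fetch_elt m a))
  | GetPriv d a =>
      quiet (obind (fun x => obind (store m d) (fetch m x)) (fetch_num m a))
  | PutPriv a s =>
      quiet (obind (fun x => obind (store m x) (fetch m s)) (fetch_num m a))
  | Read d a =>
      obind (fun x =>
        if x < shared_words g
        then omap (fun m' => (m', Some (x, None) : access T)) (store m d (sh x))
        else None) (fetch_num m a)
  | Write a s =>
      obind (fun x => obind (fun w =>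
        if x < shared_words g then Some (m, Some (x, Some w) : access T)
        else None) (fetch m s)) (fetch_num m a)
  end.

(* One operation of one processor; a processor with nothing left to execute
   stays idle. *)
Definition local_step (id : nat) (sh : memory T) (s : local T) :
    option (local T * access T) :=
  let m := priv s in
  match control s with
  | [::] => Some (s, None)
  | Op i :: k =>
      omap (fun r => (Local k r.1, r.2)) (exec_instr id sh m i)
  | If a b1 b2 :: k =>
      omap (fun v => (Local ((if v != 0 then b1 else b2) ++ k) m, None))
           (fetch_num m a)
  | While a b :: k =>
      omap (fun v =>
              (Local (if v != 0 then b ++ While a b :: k else k) m, None))
           (fetch_num m a)
  end.

Definition cell (x : access T) : option nat := omap fst x.

(* The word that an access writes in cell x, if any. *)
Definition written (x : nat) (ac : access T) : option (word T) :=
  if ac is Some (y, Some w) then (if y == x then Some w else None) else None.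

(* A synchronous step of all the processors.  The access discipline is
   exclusive read, exclusive write: two distinct processors accessing the same
   shared cell in the same step is a fault.  Hence a run that does not fault is
   a legal run with the same outcome in every variant of the PRAM. *)
Definition step (c : config g T) : option (config g T) :=
  let res (i : 'I_(procs g)) := local_step i (shared c) (proc c i) in
  let acc (i : 'I_(procs g)) : access T := obind snd (res i) in
  if [forall i, isSome (res i)] &&
     [forall i, forall j, (i != j) && isSome (cell (acc i)) ==>
                          (cell (acc i) != cell (acc j))]
  then Some (Config
    (fun x => if [pick i | isSome (written x (acc i))] is Some i
              then odflt (shared c x) (written x (acc i)) else shared c x)
    (fun i => odflt (proc c i) (omap fst (res i))))
  else None.

Definition init (prog : program) (a : seq T) : config g T :=
  Config (fun x => nth (Num 0) [seq Elt y | y <- a] x)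
         (fun _ => Local prog (fun _ => Num 0)).

Definition run (prog : program) (a : seq T) (t : nat) : option (config g T) :=
  iter t (obind step) (Some (init prog a)).

Definition halted (c : config g T) : Prop :=
  forall i : 'I_(procs g), control (proc c i) = [::].

End Semantics.

(* [accepts b] says that b is a correct final content of the array. *)
Record instance := Instance {
  elem : Type;
  oracle : elem -> elem -> bool;
  input : seq elem;
  accepts : seq elem -> Prop
}.

Definition problem := instance -> Prop.

(* After t steps every processor has stopped without any fault (hence no
   processor has performed more than t operations), and the first n words of
   the shared memory hold a correct output. *)
Definition solves (prog : program) (g : params) (I : instance) (t : nat)
    : Prop :=
  exists c : config g (elem I),
    [/\ run g (@oracle I) prog (input I) t = Some c,
        halted c
      & exists b : seq (elem I),
          accepts b /\ mkseq (shared c) (size_in g) = [seq Elt y | y <- b]].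

(* Words have c * (floor (log2 n) + 1) bits. *)
Definition word_bound (c n : nat) : nat := 2 ^ (c * (trunc_log 2 n).+1).

(* S n p: words of shared memory, K n p: words of private memory per processor,
   t n p: span.  The bound on t is t <= C * (n / p) * (log n)^d with the
   denominator cleared.  The last condition concerns the sequential run, p = 1:
   the memory used beyond the n words of the input is bounded. *)
Definition sync_strict_pip (P : problem) (prog : program) : Prop :=
  exists (c : nat) (S K t : nat -> nat -> nat),
  [/\ forall (n p : nat) (I : instance),
        P I -> size (input I) = n -> 1 <= p <= n ->
        solves prog (Params n p (S n p) (K n p) (word_bound c n)) I (t n p),
      forall n p : nat, 1 <= p <= n -> S n p = n,
      exists k : nat, forall n p : nat, 1 <= p <= n -> 1 <= K n p <= k,
      exists C d : nat, forall n p : nat, 1 <= p <= n ->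
        p * t n p <= C * n * (trunc_log 2 n).+1 ^ d
    & exists k : nat, forall n : nat, 1 <= n -> S n 1 + K n 1 <= n + k].

(* The elements carry a label; their only observable property is that label,
   which Compare reads on its first operand. *)
Definition packed (T : eqType) (label : T -> bool) (a b : seq T) : Prop :=
  perm_eq b a /\
  exists ones zeros : seq T,
    [/\ b = ones ++ zeros, all label ones & all (predC label) zeros].

Inductive packing : problem :=
  | Packing (T : eqType) (label : T -> bool) (a : seq T) :
      packing (@Instance T (fun x _ => label x) a (packed label a)).

Definition partitioned (d : Order.disp_t) (T : orderType d) (q : T)
    (a b : seq T) : Prop :=
  perm_eq b a /\
  exists l r : seq T,
    [/\ b = l ++ q :: r, all (fun x => (x < q)%O) l
      & all (fun x => (q <= x)%O) r].

(* The input is [rcons a q]: the pivot q is its last element. *)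
Inductive pivot_partition : problem :=
  | PivotPartition (d : Order.disp_t) (T : orderType d) (a : seq T) (q : T) :
      pivot_partition (@Instance T (fun x y => (x < y)%O) (rcons a q)
                                 (partitioned q (rcons a q))).

(* Main.v *)
From Stdlib Require Import FunctionalExtensionality.
From mathcomp Require Import all_boot all_order zify.
Require Import Defs.

Set Implicit Arguments.
Unset Strict Implicit.
Unset Printing Implicit Defensive.

(* One program serves both problems: an in-place sorting network in which the
   comparator on cells l < h exchanges x and y when [test y x].  It is Batcher's
   bitonic sorter with all comparators directed upwards: the first layer of a
   merge compares mirror positions of two sorted blocks, the next ones are half
   cleaners, so that comparators leaving the array can be dropped for lengths
   that are not powers of 2.  There are O(log^2 n) layers, and in each layer
   processor i treats the comparators congruent to i modulo p, hence the
   processors work on disjoint cells and never exchange information.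
   By the 0-1 principle, a predicate compatible with the comparator holds on a
   prefix of the output: the label for packing, and both [x < q] and [x <= q]
   for the partition, so that q stands right after the elements below it. *)

(** * The bitonic network *)

(* Comparator r of the layer (s, rev) joins [lo s r] to [hi s rev r], which lie
   in the blocks 2b and 2b+1 of size s, at mirror offsets when [rev]. *)
Definition flip (s : nat) (rev : bool) (o : nat) : nat :=
  if rev then s.-1 - o else o.

Definition lo (s r : nat) : nat := (r %/ s).*2 * s + r %% s.

Definition hi (s : nat) (rev : bool) (r : nat) : nat :=
  (r %/ s).*2.+1 * s + flip s rev (r %% s).

(** Common left inverse of [lo s] and [hi s rev]. The mirroring is undone in odd blocks only, since
    [lo] never mirrors. *)
Definition pair_of (s : nat) (rev : bool) (x : nat) : nat :=
  (x %/ s)./2 * s + flip s (rev && odd (x %/ s)) (x %% s).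

Definition partner (s : nat) (rev : bool) (x : nat) : nat :=
  if odd (x %/ s) then lo s (pair_of s rev x) else hi s rev (pair_of s rev x).

Lemma flip_lt s rev o : o < s -> flip s rev o < s.
Proof. rewrite /flip; case: rev => //; lia. Qed.

Lemma flipK s rev o : o < s -> flip s rev (flip s rev o) = o.
Proof. rewrite /flip; case: rev => //; lia. Qed.

Lemma lo_block s q o : o < s -> lo s (q * s + o) = q.*2 * s + o.
Proof.
move=> ho; have s0 : 0 < s by exact: leq_ltn_trans ho.
by rewrite /lo divnMDl // modnMDl divn_small // modn_small // addn0.
Qed.

Lemma hi_block s rev q o :
  o < s -> hi s rev (q * s + o) = q.*2.+1 * s + flip s rev o.
Proof.
move=> ho; have s0 : 0 < s by exact: leq_ltn_trans ho.
by rewrite /hi divnMDl // modnMDl divn_small // modn_small // addn0.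
Qed.

Lemma pair_of_block s rev b o : o < s ->
  pair_of s rev (b * s + o) = b./2 * s + flip s (rev && odd b) o.
Proof.
move=> ho; have s0 : 0 < s by exact: leq_ltn_trans ho.
by rewrite /pair_of divnMDl // modnMDl divn_small // modn_small // addn0.
Qed.

Lemma partner_block s rev b o : o < s -> partner s rev (b * s + o) =
  if odd b then b./2.*2 * s + flip s rev o else b./2.*2.+1 * s + flip s rev o.
Proof.
move=> ho; have s0 : 0 < s by exact: leq_ltn_trans ho.
rewrite /partner pair_of_block // divnMDl // divn_small // addn0.
case: (odd b); first by rewrite andbT lo_block // flip_lt.
by rewrite andbF hi_block.
Qed.

Lemma pair_of_lo s rev r : 0 < s -> pair_of s rev (lo s r) = r.
Proof.
move=> s0; rewrite /lo pair_of_block ?ltn_mod // odd_double andbF doubleK.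
by rewrite -divn_eq.
Qed.

Lemma pair_of_hi s rev r : 0 < s -> pair_of s rev (hi s rev r) = r.
Proof.
move=> s0; rewrite /hi pair_of_block ?flip_lt ?ltn_mod //= odd_double andbT.
by rewrite flipK ?ltn_mod // uphalf_double -divn_eq.
Qed.

Lemma partner_lo s rev r : 0 < s -> partner s rev (lo s r) = hi s rev r.
Proof.
by move=> s0; rewrite /lo partner_block ?ltn_mod // odd_double doubleK.
Qed.

Lemma partner_hi s rev r : 0 < s -> partner s rev (hi s rev r) = lo s r.
Proof.
move=> s0; rewrite /hi partner_block ?flip_lt ?ltn_mod //= odd_double /=.
by rewrite uphalf_double flipK ?ltn_mod.
Qed.

(** The parity of the block of [x] tells which end of its comparator [x] is; a layer is thus a
    perfect matching of all natural numbers. *)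
Lemma in_pair s rev x : 0 < s ->
  x = lo s (pair_of s rev x) \/ x = hi s rev (pair_of s rev x).
Proof.
move=> s0; rewrite (divn_eq x s); set b := x %/ s; have ho := ltn_pmod x s0.
rewrite pair_of_block //; case E: (odd b).
  right; rewrite andbT hi_block ?flip_lt // flipK //.
  by rewrite -{1}(odd_double_half b) E.
by left; rewrite andbF lo_block // -{1}(odd_double_half b) E.
Qed.

Lemma partnerK s rev x : 0 < s -> partner s rev (partner s rev x) = x.
Proof.
move=> s0; have [->|->] := in_pair rev x s0.
  by rewrite partner_lo // partner_hi.
by rewrite partner_hi // partner_lo.
Qed.

Lemma pair_of_partner s rev x : 0 < s ->
  pair_of s rev (partner s rev x) = pair_of s rev x.
Proof.
move=> s0; have [->|->] := in_pair rev x s0.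
  by rewrite partner_lo // pair_of_hi // pair_of_lo.
by rewrite partner_hi // pair_of_hi // pair_of_lo.
Qed.

Lemma lo_lt_hi s rev r : 0 < s -> lo s r < hi s rev r.
Proof. by move=> s0; rewrite /lo /hi mulSn; have := ltn_pmod r s0; lia. Qed.

(** Bounds by [n] the indices of the comparators that touch the array, hence the rounds of each
    processor. *)
Lemma pair_of_le s rev x : 0 < s -> pair_of s rev x <= x.
Proof.
move=> s0; set r := pair_of _ _ _.
have h : r <= lo s r.
  by rewrite /lo {1}(divn_eq r s) -doubleMl leq_add2r -addnn leq_addr.
have := lo_lt_hi rev r s0; have := in_pair rev x s0; rewrite -/r; lia.
Qed.

(** * Correctness of the network through the 0-1 principle *)

Section Layer.

Variables (T : Type) (test : T -> T -> bool) (n : nat).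

Definition layer (s : nat) (rev : bool) (a : nat -> T) (x : nat) : T :=
  let r := pair_of s rev x in
  if (hi s rev r < n) && test (a (hi s rev r)) (a (lo s r))
  then a (partner s rev x) else a x.

Fixpoint cleans (j : nat) (a : nat -> T) : nat -> T :=
  if j is j'.+1 then cleans j' (layer (2 ^ j') false a) else a.

Fixpoint network (k : nat) (a : nat -> T) : nat -> T :=
  if k is k'.+1 then cleans k' (layer (2 ^ k') true (network k' a)) else a.

(* The comparator orders the values of [low], with [true] first. *)
Definition respects (low : T -> bool) : Prop :=
  forall x y, if test y x then low x -> low y else low y -> low x.

(* The array is padded with infinitely many high elements. *)
Definition view (low : T -> bool) (a : nat -> T) (x : nat) : bool :=
  (x < n) && low (a x).

Variables (low : T -> bool) (lowP : respects low).

(** Seen through [low], a comparator is an OR gate at its low end and an AND gate at its high end. A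
    dropped comparator obeys the same law, because the padding is false. *)
Lemma view_lo s rev a r : 0 < s -> view low (layer s rev a) (lo s r) =
  view low a (lo s r) || view low a (hi s rev r).
Proof.
move=> s0; rewrite /view /layer pair_of_lo // partner_lo //.
have hl := lo_lt_hi rev r s0.
case: (ltnP (hi s rev r) n) => [hn|]; last by rewrite orbF.
rewrite (ltn_trans hl hn) /=; move: (lowP (a (lo s r)) (a (hi s rev r))).
by case: (test _ _); case: (low _); case: (low _) => // /(_ isT).
Qed.

Lemma view_hi s rev a r : 0 < s -> view low (layer s rev a) (hi s rev r) =
  view low a (lo s r) && view low a (hi s rev r).
Proof.
move=> s0; rewrite /view /layer pair_of_hi // partner_hi //.
have hl := lo_lt_hi rev r s0.
case: (ltnP (hi s rev r) n) => [hn|]; last by rewrite andbF.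
rewrite (ltn_trans hl hn) /=; move: (lowP (a (lo s r)) (a (hi s rev r))).
by case: (test _ _); case: (low _); case: (low _) => // /(_ isT).
Qed.

Definition block (s b : nat) (a : nat -> T) (i : nat) := view low a (b * s + i).

Lemma block_even s rev a b i : i < s -> block s b.*2 (layer s rev a) i =
  block s b.*2 a i || block s b.*2.+1 a (flip s rev i).
Proof.
move=> hi; rewrite /block -lo_block // view_lo ?hi_block //.
exact: leq_trans hi.
Qed.

Lemma block_odd s rev a b i : i < s -> block s b.*2.+1 (layer s rev a) i =
  block s b.*2 a (flip s rev i) && block s b.*2.+1 a i.
Proof.
move=> hi; have s0 : 0 < s by exact: leq_ltn_trans hi.
rewrite /block -[in LHS](flipK rev hi) -hi_block ?flip_lt // view_hi //.
by rewrite lo_block ?flip_lt // hi_block ?flip_lt // flipK.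
Qed.

Definition const (s : nat) (c : bool) (g : nat -> bool) : Prop :=
  forall i, i < s -> g i = c.

Definition descending (s : nat) (g : nat -> bool) : Prop :=
  exists u, forall i, i < s -> g i = (i < u).

(** Over Booleans, bitonic means at most two changes of value; [c] is the value outside the
    interval. *)
Definition bitonic (s : nat) (g : nat -> bool) : Prop :=
  exists c u v, forall i, i < s -> g i = c (+) (u <= i < v).

(** State after the first layer of a merge: the constant half settles the order between the halves,
    which can then be cleaned separately. *)
Definition half_sorted (s b : nat) (a : nat -> T) : Prop :=
  [/\ bitonic s (block s b.*2 a), bitonic s (block s b.*2.+1 a)
    & const s true (block s b.*2 a) \/ const s false (block s b.*2.+1 a)].

Lemma layer_bitonic s b a :
  bitonic s.*2 (block s.*2 b a) -> half_sorted s b (layer s false a).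
Proof.
case=> c [u [v h]].
have h0 i : i < s -> block s b.*2 a i = c (+) (u <= i < v).
  by move=> hi; rewrite -h; [rewrite /block -doubleMr doubleMl | lia].
have h1 i : i < s -> block s b.*2.+1 a i = c (+) (u <= s + i < v).
  move=> hi; rewrite -h; last by lia.
  by rewrite /block -doubleMr doubleMl mulSn addnA [s + _]addnC.
have e0 i : i < s -> block s b.*2 (layer s false a) i =
    (c (+) (u <= i < v)) || (c (+) (u <= s + i < v)).
  by move=> hi; rewrite block_even // h0 // h1.
have e1 i : i < s -> block s b.*2.+1 (layer s false a) i =
    (c (+) (u <= i < v)) && (c (+) (u <= s + i < v)).
  by move=> hi; rewrite block_odd // h0 // h1.
clear h h0 h1; rewrite /half_sorted /bitonic /const.
case: c e0 e1 => e0 e1.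
(* The interval from [u] to [v] lies in the low half, lies in the high half, or straddles the
   middle; in the last case its two pieces, superposed, are disjoint or overlap. *)
- have [hv|hv] := leqP v s; last have [hu|hu] := leqP s u;
    last have [huv|huv] := leqP (v - s) u.
  + split; [exists true, 0, 0 | exists true, u, v | left] => i hi;
      rewrite ?e0 ?e1 //; lia.
  + split; [exists true, 0, 0 | exists true, (u - s), (v - s) | left] => i hi;
      rewrite ?e0 ?e1 //; lia.
  + split; [exists true, 0, 0 | exists false, (v - s), u | left] => i hi;
      rewrite ?e0 ?e1 //; lia.
  + split; [exists true, u, (v - s) | exists false, 0, 0 | right] => i hi;
      rewrite ?e0 ?e1 //; lia.
- have [hv|hv] := leqP v s; last have [hu|hu] := leqP s u;
    last have [huv|huv] := leqP (v - s) u.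
  + split; [exists false, u, v | exists false, 0, 0 | right] => i hi;
      rewrite ?e0 ?e1 //; lia.
  + split; [exists false, (u - s), (v - s) | exists false, 0, 0 | right]
      => i hi; rewrite ?e0 ?e1 //; lia.
  + split; [exists true, (v - s), u | exists false, 0, 0 | right] => i hi;
      rewrite ?e0 ?e1 //; lia.
  + split; [exists true, 0, 0 | exists false, u, (v - s) | left] => i hi;
      rewrite ?e0 ?e1 //; lia.
Qed.

(** Reading the second block backwards after the first gives a bitonic sequence, on which the mirror
    layer is a half cleaner. The low block becomes all true exactly when [u + v] reaches [s]. *)
Lemma layer_descending s b a :
  descending s (block s b.*2 a) -> descending s (block s b.*2.+1 a) ->
  half_sorted s b (layer s true a).
Proof.
move=> [u hu] [v hv].
have e0 i : i < s -> block s b.*2 (layer s true a) i =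
    (i < u) || (s.-1 - i < v).
  by move=> hi; rewrite block_even // hu // hv // flip_lt.
have e1 i : i < s -> block s b.*2.+1 (layer s true a) i =
    (s.-1 - i < u) && (i < v).
  by move=> hi; rewrite block_odd // hv // hu // flip_lt.
clear hu hv; rewrite /half_sorted /bitonic /const.
have [huv|huv] := leqP s (u + v).
- split; [exists true, 0, 0 | exists false, (s - u), v | left] => i hi;
    rewrite ?e0 ?e1 //; lia.
- split; [exists true, u, (s - v) | exists false, 0, 0 | right] => i hi;
    rewrite ?e0 ?e1 //; lia.
Qed.

Lemma layer_const s b c a :
  const s.*2 c (block s.*2 b a) ->
  const s c (block s b.*2 (layer s false a)) /\
  const s c (block s b.*2.+1 (layer s false a)).
Proof.
move=> h.
have h0 i : i < s -> block s b.*2 a i = c.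
  by move=> hi; rewrite -(h i); [rewrite /block -doubleMr doubleMl | lia].
have h1 i : i < s -> block s b.*2.+1 a i = c.
  move=> hi; rewrite -(h (s + i)); last by lia.
  by rewrite /block -doubleMr doubleMl mulSn addnA [s + _]addnC.
split=> i hi; rewrite ?block_even ?block_odd // h0 // h1 //; by case: (c).
Qed.

Lemma double_blocks s b a (g : nat -> bool) :
  (forall i, i < s -> block s b.*2 a i = g i) ->
  (forall i, i < s -> block s b.*2.+1 a i = g (s + i)) ->
  forall i, i < s.*2 -> block s.*2 b a i = g i.
Proof.
move=> h0 h1 i hi; have [his|his] := ltnP i s.
  by rewrite -h0 // /block -doubleMr doubleMl.
rewrite -(subnKC his) -h1; last by lia.
by rewrite /block -doubleMr doubleMl mulSn addnA [s + b.*2 * s]addnC.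
Qed.

(** Preserves the constant half of [half_sorted] while both halves are being cleaned. *)
Lemma cleans_const j b c a :
  const (2 ^ j) c (block (2 ^ j) b a) ->
  const (2 ^ j) c (block (2 ^ j) b (cleans j a)).
Proof.
elim: j b a => [|j IH] b a //=; rewrite expnS mul2n => /layer_const[h0 h1].
by apply: double_blocks; [exact: (IH _ _ h0) | exact: (IH _ _ h1)].
Qed.

Lemma join_descending s b a :
  descending s (block s b.*2 a) -> descending s (block s b.*2.+1 a) ->
  const s true (block s b.*2 a) \/ const s false (block s b.*2.+1 a) ->
  descending s.*2 (block s.*2 b a).
Proof.
move=> [u hu] [v hv] [hc|hc].
- exists (s + v); apply: double_blocks => i hi; first by rewrite hc //; lia.
  by rewrite hv //; lia.
(* [u] may exceed [s]; without the cap the threshold would reach into the high block, which is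
   false. *)
- exists (minn u s); apply: double_blocks => i hi; first by rewrite hu //; lia.
  by rewrite hc //; lia.
Qed.

(** The assumption on bitonic blocks is the induction hypothesis in [cleans_bitonic], and
    [cleans_bitonic] itself in [network_descending]. *)
Lemma cleans_half_sorted j b a : 
  (forall b' a', bitonic (2 ^ j) (block (2 ^ j) b' a') ->
     descending (2 ^ j) (block (2 ^ j) b' (cleans j a'))) ->
  half_sorted (2 ^ j) b a -> 
  descending (2 ^ j.+1) (block (2 ^ j.+1) b (cleans j a)).
Proof.
move=> IH [h0 h1 hc]; rewrite expnS mul2n.
apply: join_descending; [exact: IH | exact: IH |].
by case: hc => hc; [left | right]; apply: cleans_const.
Qed.

Lemma cleans_bitonic j b a :
  bitonic (2 ^ j) (block (2 ^ j) b a) ->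
  descending (2 ^ j) (block (2 ^ j) b (cleans j a)).
Proof.
elim: j b a => [|j IH] b a.
  case=> c [u [v h]]; exists (c (+) (u <= 0 < v)) => -[|//] _.
  by rewrite h //; case: (_ (+) _).
rewrite expnS mul2n => /layer_bitonic /(cleans_half_sorted IH).
by rewrite expnS mul2n.
Qed.

Lemma network_descending k b a :
  descending (2 ^ k) (block (2 ^ k) b (network k a)).
Proof.
elim: k b => [|k IH] b.
  by exists (block 1 b a 0) => -[|//] _ /=; case: (block _ _ _ _).
apply: (cleans_half_sorted (@cleans_bitonic k)); exact: layer_descending.
Qed.

End Layer.

(** * The network permutes the array *)

Section LayerPerm.

Variables (T : eqType) (test : T -> T -> bool) (n : nat).

(** A layer precomposes the array with [pi], which swaps the ends of the active comparators. It is
    an involution because activity depends only on the pair, and it preserves the indices below [n]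
    because active comparators lie inside the array. *)
Lemma perm_layer s rev a : 0 < s ->
  perm_eq (mkseq (layer test n s rev a) n) (mkseq a n).
Proof.
move=> s0; pose sw r := (hi s rev r < n) && test (a (hi s rev r)) (a (lo s r)).
pose pi x := if sw (pair_of s rev x) then partner s rev x else x.
have piK : involutive pi.
  move=> x; rewrite /pi; case hx: (sw (pair_of s rev x)); last by rewrite hx.
  by rewrite pair_of_partner // hx partnerK.
have pin x : x < n -> pi x < n.
  rewrite /pi; case: ifP => // /andP[hh _] _.
  have hl := ltn_trans (lo_lt_hi rev (pair_of s rev x) s0) hh.
  have [e|e] := in_pair rev x s0.
    by rewrite {1}e partner_lo.
  by rewrite {1}e partner_hi.
have -> : mkseq (layer test n s rev a) n = map a (map pi (iota 0 n)).
  rewrite -map_comp; apply: eq_map => x; rewrite /layer /pi /sw /=.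
  by case: ifP.
apply/perm_map/uniq_perm; rewrite ?iota_uniq //.
  by rewrite (map_inj_uniq (inv_inj piK)) iota_uniq.
move=> x; rewrite mem_iota add0n /=; apply/mapP/idP => [[y + ->]|hx].
  by rewrite mem_iota add0n; exact: pin.
by exists (pi x); rewrite ?piK // mem_iota add0n pin.
Qed.

Lemma perm_cleans j a : perm_eq (mkseq (cleans test n j a) n) (mkseq a n).
Proof.
elim: j a => [|j IH] a //=.
by apply: (perm_trans (IH _)); apply: perm_layer; rewrite expn_gt0.
Qed.

Lemma perm_network k a : perm_eq (mkseq (network test n k a) n) (mkseq a n).
Proof.
elim: k => [|k IH] //=; apply: (perm_trans (perm_cleans _ _)).
by apply: (perm_trans _ IH); apply: perm_layer; rewrite expn_gt0.
Qed.

End LayerPerm.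

(** * Runs on disjoint cells *)

Section Solo.

Variables (g : params) (T : Type) (test : T -> T -> bool).

Definition apply_access (ac : access T) (sh : memory T) : memory T :=
  if ac is Some (x, Some w) then upd sh x w else sh.

Definition within (D : nat -> bool) (ac : access T) : bool :=
  if cell ac is Some x then D x else true.

(** One processor alone on its own copy of the shared memory. An access outside [D] is a fault, so a
    successful run certifies confinement to [D]. *)
Definition solo (D : nat -> bool) (id : nat) (st : memory T * local T) :
    option (memory T * local T) :=
  if local_step g test id st.1 st.2 is Some (s, ac)
  then (if within D ac then Some (apply_access ac st.1, s) else None)
  else None.

Definition solo_run D id N st := iter N (obind (solo D id)) (Some st).

Definition par_run N (c : config g T) := iter N (obind (step test)) (Some c).

Lemma iter_obind_none (A : Type) (f : A -> option A) N :
  iter N (obind f) None = None.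
Proof. by elim: N => //= N ->. Qed.

Lemma solo_runS D id N st :
  solo_run D id N.+1 st = obind (solo_run D id N) (solo D id st).
Proof.
rewrite /solo_run iterSr /=; case: (solo D id st) => //=.
exact: iter_obind_none.
Qed.

Lemma solo_run_add D id N M st st' : solo_run D id N st = Some st' ->
  solo_run D id (N + M) st = solo_run D id M st'.
Proof. by rewrite /solo_run addnC iterD => ->. Qed.

Lemma par_run_add N M c c' :
  par_run N c = Some c' -> par_run (N + M) c = par_run M c'.
Proof. by rewrite /par_run addnC iterD => ->. Qed.

(** Only [Read] depends on the shared memory, and only through the cell it reports. *)
Lemma local_step_eq id sh sh' s r :
  local_step g test id sh s = Some r ->
  (forall x, cell r.2 = Some x -> sh x = sh' x) ->
  local_step g test id sh' s = Some r.
Proof.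
case: s => -[//|[i|a b1 b2|a b] k] m; rewrite /local_step /=; try by [].
case: i => //= d a.
case: (fetch_num g m a) => //= x; case: ifP => //= _.
case E: (store g m d (sh x)) => [m'|] //= [<-] /= /(_ x erefl) <-.
by rewrite E.
Qed.

(** Disjoint domains give exclusive access, and a cell of [D i] can be written by processor [i]
    only, so the [pick] in [step] agrees with the solo effect. *)
Lemma step_solo (D : 'I_(procs g) -> nat -> bool) (c : config g T) S S' P :
  (forall i j x, D i x -> D j x -> i = j) ->
  (forall i x, D i x -> S i x = shared c x) ->
  (forall i, solo (D i) i (S i, proc c i) = Some (S' i, P i)) ->
  exists c', [/\ step test c = Some c', forall i, proc c' i = P i,
    forall i x, D i x -> S' i x = shared c' x
    & forall x, (forall i, ~~ D i x) -> shared c' x = shared c x].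
Proof.
move=> Ddisj DS hsolo.
have /fin_all_exists[ac hac] : forall i : 'I_(procs g), exists ac,
    [/\ local_step g test i (shared c) (proc c i) = Some (P i, ac),
        within (D i) ac & S' i = apply_access ac (S i)].
  move=> i; move: (hsolo i); rewrite /solo /=.
  case E: (local_step _ _ _ _ _) => [[s ac]|] //; case: ifP => // hw [<- <-].
  exists ac; split=> //; apply: (local_step_eq E) => x /= hx; apply: DS.
  by move: hw; rewrite /within hx.
have hcell i x : cell (ac i) = Some x -> D i x.
  by move=> hx; have [_ + _] := hac i; rewrite /within hx.
have hwr i x w : written x (ac i) = Some w -> ac i = Some (x, Some w).
  by case: (ac i) => [[y [v|]]|] //=; case: eqP => // -> [->].
have hwrD i x : isSome (written x (ac i)) -> D i x.
  case E: (written x (ac i)) => [w|] // _.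
  by apply: hcell; rewrite (hwr _ _ _ E).
rewrite /step; case: ifP => [_|/negP[]]; last first.
  apply/andP; split; first by apply/forallP => i; have [-> _ _] := hac i.
  apply/forallP => i; apply/forallP => j; apply/implyP => /andP[ij].
  have [-> _ _] := hac i; have [-> _ _] := hac j => /=.
  case E: (cell (ac i)) => [x|] // _; apply: contra ij => /eqP /esym E'.
  by apply/eqP; apply: (Ddisj i j x); apply: hcell.
eexists; split; first by [].
- by move=> i /=; have [-> _ _] := hac i.
- move=> i x Dx /=; have [_ _ ->] := hac i.
  case: pickP => [j|hno].
    have [-> _ _] := hac j => /= hj.
    rewrite (Ddisj i j x Dx (hwrD _ _ hj)).
    case E: (written x (ac j)) hj => [w|] // _.
    by rewrite (hwr _ _ _ E) /= /upd eqxx.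
  move: (hno i); have [-> _ _] := hac i => /=.
  rewrite -(DS i x Dx); case: (ac i) => [[y [w|]]|] //=.
  by rewrite /upd eq_sym; case: eqP.
- move=> x hx /=; case: pickP => [j|//]; have [-> _ _] := hac j => /= hj.
  by move: (hx j); rewrite (hwrD _ _ hj).
Qed.

(* Processors confined to disjoint sets of cells can be run one at a time. *)
Lemma par_run_solo (D : 'I_(procs g) -> nat -> bool) N (c : config g T) S P :
  (forall i j x, D i x -> D j x -> i = j) ->
  (forall i, solo_run (D i) i N (shared c, proc c i) = Some (S i, P i)) ->
  exists c', [/\ par_run N c = Some c', forall i, proc c' i = P i,
    forall i x, D i x -> shared c' x = S i x
    & forall x, (forall i, ~~ D i x) -> shared c' x = shared c x].
Proof.
(* The induction needs private copies that agree with the shared memory on [D i] only: after one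
   step a copy misses the writes of the other processors. *)
move=> Ddisj; suff gen : forall S0,
    (forall i x, D i x -> S0 i x = shared c x) ->
    (forall i, solo_run (D i) i N (S0 i, proc c i) = Some (S i, P i)) ->
    exists c', [/\ par_run N c = Some c', forall i, proc c' i = P i,
      forall i x, D i x -> shared c' x = S i x
      & forall x, (forall i, ~~ D i x) -> shared c' x = shared c x].
  exact: (gen (fun=> shared c)).
elim: N c => [|N IH] c S0 DS hrun.
  exists c; split=> //; first by move=> i; case: (hrun i).
  by move=> i x Dx; case: (hrun i) => <- _; rewrite DS.
have /fin_all_exists[st hst] : forall i : 'I_(procs g), exists st,
    solo (D i) i (S0 i, proc c i) = Some st /\
    solo_run (D i) i N st = Some (S i, P i).
  move=> i; move: (hrun i); rewrite solo_runS.
  by case: (solo _ _ _) => // st h; exists st.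
have [i|c1 [e1 p1 s1 o1]] :=
    @step_solo D c S0 (fun i => (st i).1) (fun i => (st i).2) Ddisj DS.
  by have [-> _] := hst i; case: (st i).
have [//|i|c' [e2 p2 s2 o2]] := IH c1 (fun i => (st i).1).
  by rewrite p1 -surjective_pairing; have [] := hst i.
exists c'; split=> //; last by move=> x hx; rewrite o2 // o1.
by rewrite /par_run iterSr /= e1.
Qed.

End Solo.

(** * Proof rules for the run of a single processor *)

Section Exec.

Variables (g : params) (T : Type) (test : T -> T -> bool).
Variables (D : nat -> bool) (id : nat).

(** Private memories given by lists make updates compute, so that execution proceeds by
    simplification. *)
Definition bank (l : seq (word T)) : memory T := nth (Num 0) l.

(** The number of steps is exact, not a bound: synchronous processors are combined only at a common
    time. *)
Definition exec N (st : memory T * local T) (Q : memory T * local T -> Prop) :=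
  exists2 st', solo_run g test D id N st = Some st' & Q st'.

Implicit Types (sh : memory T) (l : seq (word T)) (k : program).

Lemma upd_bank l d w : upd (bank l) d w = bank (set_nth (Num 0) l d w).
Proof.
by apply: functional_extensionality => x; rewrite /bank nth_set_nth.
Qed.

Lemma exec_weaken N st (Q R : memory T * local T -> Prop) :
  exec N st Q -> (forall st', Q st' -> R st') -> exec N st R.
Proof. by move=> [st' e Qst'] QR; exists st'; last exact: QR. Qed.

Lemma exec_seq N M st (Q R : memory T * local T -> Prop) :
  exec N st Q -> (forall st', Q st' -> exec M st' R) -> exec (N + M) st R.
Proof.
by move=> [st' e Qst'] /(_ _ Qst')[st2 e2 R2]; exists st2;
  rewrite ?(solo_run_add _ e).
Qed.

Lemma exec_step N st st' Q :
  solo g test D id st = Some st' -> exec N st' Q -> exec N.+1 st Q.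
Proof. by move=> e [st2 e2 Q2]; exists st2; rewrite // solo_runS e. Qed.

Lemma exec_set N sh l k d v Q :
  d < priv_words g -> immediate_val g id v < word_max g ->
  exec N
    (sh, Local k (bank (set_nth (Num 0) l d (Num (immediate_val g id v))))) Q ->
  exec N.+1 (sh, Local (Op (Set_ d v) :: k) (bank l)) Q.
Proof.
move=> hd hv; apply: exec_step.
by rewrite /solo /local_step /= /store hd /= hv /= upd_bank.
Qed.

Lemma exec_move N sh l k d s Q :
  d < priv_words g -> s < priv_words g ->
  fits (word_max g) (nth (Num 0) l s) ->
  exec N (sh, Local k (bank (set_nth (Num 0) l d (nth (Num 0) l s)))) Q ->
  exec N.+1 (sh, Local (Op (Move d s) :: k) (bank l)) Q.
Proof.
move=> hd hs hv; apply: exec_step.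
rewrite /solo /local_step /= /fetch hs /= /store hd /= /bank hv /=.
by rewrite -[nth (Num 0) l]/(bank l) upd_bank.
Qed.

(** The result [z] is supplied by the caller, which keeps register contents in a chosen closed
    form. *)
Lemma exec_arith z N sh l k o d a b x y Q :
  [&& d < priv_words g, a < priv_words g & b < priv_words g] ->
  nth (Num 0) l a = Num x -> nth (Num 0) l b = Num y ->
  eval_binop o x y = z -> z < word_max g ->
  exec N (sh, Local k (bank (set_nth (Num 0) l d (Num z)))) Q ->
  exec N.+1 (sh, Local (Op (Arith o d a b) :: k) (bank l)) Q.
Proof.
move=> /and3P[hd ha hb] hx hy hz hv; apply: exec_step.
move: hv; rewrite -hz => hv.
rewrite /solo /local_step /= /fetch_num /fetch ha hb /= /bank hx hy /=.
by rewrite /store hd /= hv /= -[nth (Num 0) l]/(bank l) upd_bank.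
Qed.

Lemma exec_compare N sh l k d a b x y Q :
  [&& d < priv_words g, a < priv_words g & b < priv_words g] ->
  nth (Num 0) l a = Elt x -> nth (Num 0) l b = Elt y -> 1 < word_max g ->
  exec N (sh, Local k (bank (set_nth (Num 0) l d (Num (test x y))))) Q ->
  exec N.+1 (sh, Local (Op (Compare d a b) :: k) (bank l)) Q.
Proof.
move=> /and3P[hd ha hb] hx hy hv; apply: exec_step.
have {}hv : test x y < word_max g by case: (test x y); rewrite // ltnW.
rewrite /solo /local_step /= /fetch_elt /fetch ha hb /= /bank hx hy /=.
by rewrite /store hd /= hv /= -[nth (Num 0) l]/(bank l) upd_bank.
Qed.

Lemma exec_read N sh l k d a x y Q :
  (d < priv_words g) && (a < priv_words g) -> nth (Num 0) l a = Num x ->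
  x < shared_words g -> D x -> sh x = Elt y ->
  exec N (sh, Local k (bank (set_nth (Num 0) l d (Elt y)))) Q ->
  exec N.+1 (sh, Local (Op (Read d a) :: k) (bank l)) Q.
Proof.
move=> /andP[hd ha] hx hxs Dx hy; apply: exec_step.
rewrite /solo /local_step /= /fetch_num /fetch ha /= /bank hx /= hxs hy /store.
by rewrite hd /= /within /= Dx -[nth (Num 0) l]/(bank l) upd_bank.
Qed.

Lemma exec_write N sh l k a s x Q :
  (s < priv_words g) && (a < priv_words g) -> nth (Num 0) l a = Num x ->
  x < shared_words g -> D x ->
  exec N (upd sh x (nth (Num 0) l s), Local k (bank l)) Q ->
  exec N.+1 (sh, Local (Op (Write a s) :: k) (bank l)) Q.
Proof.
move=> /andP[hs ha] hx hxs Dx; apply: exec_step.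
rewrite /solo /local_step /= /fetch_num /fetch ha hs /= /bank hx /= hxs.
by rewrite /within /= Dx.
Qed.

Lemma exec_if N sh l k a b1 b2 v Q :
  a < priv_words g -> nth (Num 0) l a = Num v ->
  exec N (sh, Local ((if v != 0 then b1 else b2) ++ k) (bank l)) Q ->
  exec N.+1 (sh, Local (If a b1 b2 :: k) (bank l)) Q.
Proof.
move=> ha hv; apply: exec_step.
by rewrite /solo /local_step /= /fetch_num /fetch ha /= /bank hv.
Qed.

Lemma exec_while N sh l k a b v Q :
  a < priv_words g -> nth (Num 0) l a = Num v ->
  exec N
    (sh, Local (if v != 0 then b ++ While a b :: k else k) (bank l)) Q ->
  exec N.+1 (sh, Local (While a b :: k) (bank l)) Q.
Proof.
move=> ha hv; apply: exec_step.
by rewrite /solo /local_step /= /fetch_num /fetch ha /= /bank hv.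
Qed.

End Exec.

(** * The program *)

(* Private memory: 0 n, 1 p, 2 processor number, 3 the constant 1, 4 the size m
   of the blocks being merged, 5 the block size s of the current layer, 6 the
   number e such that [flip s rev o] is the distance from o to e, 7 the number
   of comparators left to this processor, 8 loop condition, 9 and 10 the two
   cells, 11 to 14 scratch.  The branches of each [If] have the same length,
   which keeps the processors in step. *)
Definition compare_exchange : program :=
  [:: Op (Arith Sub 7 7 3); Op (Arith Mul 9 7 1); Op (Arith Add 9 9 2);
      Op (Arith Div 10 9 5); Op (Arith Mod 11 9 5); Op (Arith Mul 10 10 5);
      Op (Arith Add 10 10 10); Op (Arith Add 9 10 11); Op (Arith Add 10 10 5);
      Op (Arith Sub 12 6 11); Op (Arith Sub 11 11 6); Op (Arith Add 11 11 12);
      Op (Arith Add 10 10 11); Op (Arith Lt 11 10 0);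
      If 11
        [:: Op (Read 12 9); Op (Read 13 10); Op (Compare 14 13 12);
            If 14 [:: Op (Write 9 13); Op (Write 10 12)]
                  [:: Op (Write 9 12); Op (Write 10 13)]]
        (nseq 6 (Op (Move 0 0)))].

Definition layer_code : program :=
  [:: Op (Arith Div 7 0 1); Op (Arith Add 7 7 3); While 7 compare_exchange;
      Op (Arith Add 8 3 3); Op (Arith Div 5 5 8); Op (Set_ 6 (Literal 0))].

Definition stage_code : program :=
  [:: Op (Move 5 4); Op (Arith Sub 6 4 3); While 5 layer_code;
      Op (Arith Add 4 4 4); Op (Arith Lt 8 4 0)].

Definition sorter : program :=
  [:: Op (Set_ 0 InputSize); Op (Set_ 1 NumProcs); Op (Set_ 2 ProcId);
      Op (Set_ 3 (Literal 1)); Op (Set_ 4 (Literal 1)); Op (Arith Lt 8 4 0);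
      While 8 stage_code].

Ltac arith z :=
  eapply (exec_arith (z := z));
  [ by [] | reflexivity | reflexivity
  | (rewrite /=; done) || (rewrite /=; lia)
  | (rewrite /=; done) || (rewrite /=; lia)
  | rewrite /=].

(** * Run of one processor: a comparator, a round of comparators, a layer *)

Section Sorter.

Variables (n p W : nat) (T : Type) (test : T -> T -> bool).
Hypotheses (p0 : 0 < p) (pn : p <= n) (hW : 8 * n <= W).

Let g := Params n p n 15 W.

Definition regs id m s e cnt c (j : seq (word T)) : seq (word T) :=
  [:: Num n; Num p; Num id; Num 1; Num m; Num s; Num e; Num cnt; Num c] ++ j.

(** The list [j] stands for registers 9 to 14, which may hold anything between two comparators. *)
Definition ready k id m s e cnt c (s' : local T) : Prop :=
  exists2 j, size j = 6 & s' = Local k (bank (regs id m s e cnt c j)).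

Definition footprint s rev id x : bool := pair_of s rev x %% p == id.

(* The processor treats its comparators by decreasing index, [cnt] of them
   remaining. *)
Definition progress s rev id (a : nat -> T) cnt (sh : memory T) : Prop :=
  forall x, x < n -> footprint s rev id x ->
    sh x = Elt (if cnt * p <= pair_of s rev x then layer test n s rev a x
                else a x).

Definition centre (rev : bool) (s : nat) : nat := if rev then s.-1 else 0.

(** Among [p] consecutive comparator indices starting at a multiple of [p], only one has residue
    [id]. *)
Lemma in_footprint s rev id x cnt : 0 < s -> footprint s rev id x ->
  cnt * p <= pair_of s rev x < cnt.+1 * p ->
  x = lo s (cnt * p + id) \/ x = hi s rev (cnt * p + id).
Proof.
move=> s0 /eqP hx /andP[h1 h2].
have <- : pair_of s rev x = cnt * p + id; last exact: in_pair.
rewrite {1}(divn_eq (pair_of s rev x) p) hx; congr (_ * _ + _).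
by apply/eqP; rewrite eqn_leq leq_divRL // h1 andbT -ltnS ltn_divLR.
Qed.

Lemma progress_next s rev id a cnt sh sh' :
  id < p -> 0 < s ->
  let l := lo s (cnt * p + id) in let h := hi s rev (cnt * p + id) in
  progress s rev id a cnt.+1 sh ->
  (forall x, x != l -> x != h -> sh' x = sh x) ->
  (l < n -> sh' l = Elt (layer test n s rev a l)) ->
  (h < n -> sh' h = Elt (layer test n s rev a h)) ->
  progress s rev id a cnt sh'.
Proof.
move=> hid s0 l h hI hother hl hh x xn Dx.
have [h1|h1] := leqP (cnt * p) (pair_of s rev x).
- have [h2|h2] := leqP (cnt.+1 * p) (pair_of s rev x).
    rewrite hother; first by rewrite hI // h2.
      by apply/eqP => e; move: h2; rewrite e pair_of_lo // mulSn; lia.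
    by apply/eqP => e; move: h2; rewrite e pair_of_hi // mulSn; lia.
  have [|e|e] := in_footprint (cnt := cnt) s0 Dx; first by rewrite h1.
    by rewrite e hl // -/l /l -e.
  by rewrite e hh // -/h /h -e.
- rewrite hother.
  + by rewrite hI // leqNgt (leq_trans h1) // mulSn leq_addl.
  + by apply/eqP => e; move: h1; rewrite e pair_of_lo //; lia.
  + by apply/eqP => e; move: h1; rewrite e pair_of_hi //; lia.
Qed.

(** The 21 steps are 14 arithmetic operations, the outer [If], and a branch of 6 steps. Indices are
    below [2 * n] and [s < n], so addresses stay below [6 * n] and fit in a word. *)
Lemma exec_exchange id m s rev cnt c a sh st k :
  id < p -> 0 < s < n -> cnt <= n %/ p -> progress s rev id a cnt.+1 sh ->
  ready (compare_exchange ++ k) id m s (centre rev s) cnt.+1 c st ->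
  exec g test (footprint s rev id) id 21 (sh, st)
    (fun st' => progress s rev id a cnt st'.1 /\
       ready k id m s (centre rev s) cnt c st'.2).
Proof.
move=> hid /andP[s0 sn] hcnt hI [j].
case: j => [|w9 [|w10 [|w11 [|w12 [|w13 [|w14 [|]]]]]]] //= _ ->.
rewrite /compare_exchange /=.
have cn : cnt <= n by exact: leq_trans hcnt (leq_div _ _).
have hn : 0 < n by exact: leq_trans pn.
have: cnt * p <= n.
  by rewrite (leq_trans _ (leq_divM n p)) // leq_mul2r hcnt orbT.
have := leq_divM (cnt * p + id) s; have := leq_div (cnt * p + id) s.
(* Subtraction is truncated, so one of the two differences is 0 and their sum is a distance. *)
have: (cnt * p + id) %% s - centre rev s +
    (centre rev s - (cnt * p + id) %% s) = flip s rev ((cnt * p + id) %% s).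
  have := ltn_pmod (cnt * p + id) s0; move: (_ %% s).
  by rewrite /centre /flip; case: (rev); lia.
have := flip_lt rev (ltn_pmod (cnt * p + id) s0).
have: (cnt * p + id) %/ s * s + (cnt * p + id) %/ s * s + (cnt * p + id) %% s =
       lo s (cnt * p + id) by rewrite /lo -addnn mulnDl.
have: (cnt * p + id) %/ s * s + (cnt * p + id) %/ s * s + s +
       flip s rev ((cnt * p + id) %% s) = hi s rev (cnt * p + id).
  by rewrite /hi -addnn mulSn mulnDl; lia.
have := ltn_pmod (cnt * p + id) s0.
have: centre rev s <= s by rewrite /centre; case: (rev); lia.
have := lo_lt_hi rev (cnt * p + id) s0.
have D1 : footprint s rev id (lo s (cnt * p + id)).
  by rewrite /footprint pair_of_lo // modnMDl modn_small.
have D2 : footprint s rev id (hi s rev (cnt * p + id)).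
  by rewrite /footprint pair_of_hi // modnMDl modn_small.
have := hI _ _ D1; have := hI _ _ D2.
have hr : (cnt.+1 * p <= cnt * p + id) = false by rewrite mulSn; lia.
rewrite pair_of_lo // pair_of_hi // hr.
have := @progress_next s rev id a cnt sh _ hid s0 hI.
rewrite /layer pair_of_lo // pair_of_hi // partner_lo // partner_hi //.
move: D1 D2; clear hI hr hcnt.
(* Quotient, remainder and addresses become variables; the facts accumulated in the goal let [lia]
   check every intermediate value. *)
move Eq: (_ %/ s) => q; move Eo: (_ %% s) => o.
move: (flip s rev _) (hi s rev _) (lo s _) => fl h l D1 D2 next.
move=> sh2 sh1 lh es os eh el fls efl qr qsr cp.
arith cnt. arith (cnt * p). arith (cnt * p + id). arith q.
arith o. arith (q * s). arith (q * s + q * s). arith l.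
arith (q * s + q * s + s).
arith (centre rev s - o). arith (o - centre rev s). arith fl. arith h.
arith (nat_of_bool (h < n)).
eapply exec_if; [by [] | reflexivity | rewrite /=].
have [hn2|hn2] := ltnP h n; rewrite /=; last first.
  do 6 (apply: exec_move; [by [] | by [] | rewrite /=; lia | rewrite /=]).
  exists (sh, Local k (bank
    [:: Num n; Num p; Num id; Num 1; Num m; Num s; Num (centre rev s); Num cnt;
      Num c; Num l; Num h; Num 0; Num (centre rev s - o); w13; w14])) => //.
  split; last by eexists [:: _; _; _; _; _; _]; last reflexivity.
  apply: next => //= hx; first by rewrite sh1 // (ltnNge h) hn2.
  by move: hx; rewrite ltnNge hn2.
have {}sh1 := sh1 (ltn_trans lh hn2); have {}sh2 := sh2 hn2.
eapply exec_read; [by [] | reflexivity | by rewrite /=; lia | by [] | exact: sh1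
  | rewrite /=].
eapply exec_read; [by [] | reflexivity | by rewrite /=; lia | by [] | exact: sh2
  | rewrite /=].
eapply exec_compare; [by [] | reflexivity | reflexivity | by rewrite /=; lia
  | rewrite /=].
eapply exec_if; [by [] | reflexivity | rewrite /=].
case Et: (test _ _) => /=.
- do 2 (eapply exec_write;
    [by [] | reflexivity | by rewrite /=; lia | by [] | rewrite /=]).
  eexists; first reflexivity.
  split; last by eexists [:: _; _; _; _; _; _]; last reflexivity.
  apply: next => /= [x hxl hxh|_|_]; rewrite /upd.
  + by rewrite (negbTE hxl) (negbTE hxh).
  + by rewrite (ltn_eqF lh) eqxx hn2 Et.
  + by rewrite eqxx hn2 Et.
- do 2 (eapply exec_write;
    [by [] | reflexivity | by rewrite /=; lia | by [] | rewrite /=]).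
  eexists; first reflexivity.
  split; last by eexists [:: _; _; _; _; _; _]; last reflexivity.
  apply: next => /= [x hxl hxh|_|_]; rewrite /upd.
  + by rewrite (negbTE hxl) (negbTE hxh).
  + by rewrite (ltn_eqF lh) eqxx hn2 Et.
  + by rewrite eqxx hn2 Et.
Qed.

(** A round costs 21 steps and one loop test; the extra step is the test that leaves the loop. *)
Lemma exec_exchanges id m s rev cnt c a sh st k :
  id < p -> 0 < s < n -> cnt <= (n %/ p).+1 -> progress s rev id a cnt sh ->
  ready (While 7 compare_exchange :: k) id m s (centre rev s) cnt c st ->
  exec g test (footprint s rev id) id (cnt * 22).+1 (sh, st)
    (fun st' => progress s rev id a 0 st'.1 /\
       ready k id m s (centre rev s) 0 c st'.2).
Proof.
move=> hid hs; elim: cnt sh st => [|cnt IH] sh st hcnt hI [j hj ->].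
  eapply exec_while; [by [] | reflexivity | rewrite [X in Local X _]/=].
  by eexists; first reflexivity; split=> //; exists j.
have -> : (cnt.+1 * 22).+1 = (21 + (cnt * 22).+1).+1 by lia.
eapply exec_while; [by [] | reflexivity | rewrite [X in Local X _]/=].
apply: exec_seq.
  by apply: (exec_exchange (c := c) (st := Local _ _) hid hs hcnt hI); exists j.
by move=> [sh' st'] [/= hI' hst']; apply: IH => //; exact: ltnW.
Qed.

Lemma exec_layer id m s rev cnt c a sh st k :
  id < p -> 0 < s < n ->
  (forall x, x < n -> footprint s rev id x -> sh x = Elt (a x)) ->
  ready (While 5 layer_code :: k) id m s (centre rev s) cnt c st ->
  exec g test (footprint s rev id) id ((n %/ p).+1 * 22 + 7) (sh, st)
    (fun st' => (forall x, x < n -> footprint s rev id x ->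
        st'.1 x = Elt (layer test n s rev a x)) /\
       ready (While 5 layer_code :: k) id m (s %/ 2) 0 0 2 st'.2).
Proof.
move=> hid hs ha [j hj ->]; have /andP[s0 sn] := hs.
have hnp := leq_div n p.
have -> : (n %/ p).+1 * 22 + 7 = (2 + (((n %/ p).+1 * 22).+1 + 3)).+1 by lia.
eapply exec_while; [by [] | reflexivity | rewrite [X in Local X _]/=].
rewrite -lt0n s0 /layer_code [X in Local X _]/= /regs.
arith (n %/ p). arith (n %/ p).+1.
apply: (@exec_seq _ _ _ _ _ _ _ _
  (fun st' => progress s rev id a 0 st'.1 /\ ready _ id m s _ 0 c st'.2)).
  apply: exec_exchanges => //; last by exists j.
  (* The pair index is at most [x < n < (n %/ p).+1 * p], so no comparator touching the array counts
     as treated at the start. *)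
  move=> x xn Dx; rewrite leqNgt (leq_ltn_trans (pair_of_le rev x s0)) ?ha //.
  by rewrite (ltn_trans xn) // ltn_ceil.
move=> [sh' st'] [/= hI [j' hj' ->]]; rewrite /regs.
arith 2.
arith (s %/ 2).
apply: exec_set; [by [] | by rewrite /=; lia | rewrite /=].
eexists; first reflexivity; split; last by exists j'.
by move=> x xn Dx; rewrite /= hI // mul0n.
Qed.

(** * Synchronous runs of all the processors *)

Definition holds (a : nat -> T) (cf : config g T) : Prop :=
  forall x, x < n -> shared cf x = Elt (a x).

(** Lifts solo specifications to the whole machine; a cell in no domain must hold its final value
    beforehand. *)
Lemma par_exec (D : 'I_p -> nat -> bool) N (cf : config g T) a
    (R : 'I_p -> local T -> Prop) :
  (forall i j x, D i x -> D j x -> i = j) ->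
  (forall x, x < n -> (forall i, ~~ D i x) -> shared cf x = Elt (a x)) ->
  (forall i : 'I_p, exec g test (D i) i N (shared cf, proc cf i) (fun st' =>
     (forall x, x < n -> D i x -> st'.1 x = Elt (a x)) /\ R i st'.2)) ->
  exists cf', [/\ par_run test N cf = Some cf', holds a cf'
    & forall i, R i (proc cf' i)].
Proof.
move=> Ddisj hout hex.
have /fin_all_exists[st hst] : forall i : 'I_p, exists st',
    solo_run g test (D i) i N (shared cf, proc cf i) = Some st' /\
    ((forall x, x < n -> D i x -> st'.1 x = Elt (a x)) /\ R i st'.2).
  by move=> i; have [st' e h] := hex i; exists st'.
have [i|cf' [e pr sin sout]] := @par_run_solo g T test D N cf
    (fun i => (st i).1) (fun i => (st i).2) Ddisj.
  by rewrite -surjective_pairing; have [] := hst i.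
exists cf'; split=> // [x xn|i]; last by rewrite pr; have [_ []] := hst i.
case: (pickP (fun i => D i x)) => [i Dx|hD].
  by rewrite (sin i) //; have [_ [h _]] := hst i; rewrite h.
have hD' i : ~~ D i x by rewrite hD.
by rewrite sout // hout.
Qed.

(** Empty domains handle the stretches of code without shared accesses. *)
Lemma par_private N (cf : config g T) a (R : 'I_p -> local T -> Prop) :
  holds a cf ->
  (forall i : 'I_p, exec g test (fun=> false) i N (shared cf, proc cf i)
     (fun st' => R i st'.2)) ->
  exists cf', [/\ par_run test N cf = Some cf', holds a cf'
    & forall i, R i (proc cf' i)].
Proof.
move=> ha hex; apply: (@par_exec (fun _ _ => false)) => // [x xn _|i].
  exact: ha.
by apply: (exec_weaken (hex i)) => st' h; split.
Qed.

Definition synced k m s e (cf : config g T) : Prop :=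
  forall i : 'I_p, exists cnt c, ready k i m s e cnt c (proc cf i).

(** The residues modulo [p] of the comparator indices partition the cells: footprints are disjoint
    and cover the array. *)
Lemma par_layer m s rev a (cf : config g T) k :
  0 < s < n -> holds a cf ->
  synced (While 5 layer_code :: k) m s (centre rev s) cf ->
  exists cf', [/\ par_run test ((n %/ p).+1 * 22 + 7) cf = Some cf',
    holds (layer test n s rev a) cf'
    & synced (While 5 layer_code :: k) m (s %/ 2) 0 cf'].
Proof.
move=> hs ha hsync.
apply: (@par_exec (fun i => footprint s rev i) _ _ _
  (fun i st => exists cnt c, ready (While 5 layer_code :: k) i m _ 0 cnt c st)).
- by move=> i j x /eqP hi /eqP hj; apply: val_inj; rewrite /= -hi -hj.
- move=> x xn /(_ (Ordinal (ltn_pmod (pair_of s rev x) p0))).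
  by rewrite /footprint eqxx.
- move=> i; have [cnt [c hr]] := hsync i.
  apply: (exec_weaken (exec_layer (ltn_ord i) hs _ hr)) => [x xn _|st' [h1 h2]].
    exact: ha.
  by split=> //; exists 0, 2.
Qed.

(* [2 ^ j %/ 2] is [2 ^ j.-1], and [0] when [j = 0], which ends the loop. *)
Lemma par_cleans m j a (cf : config g T) k :
  2 ^ j %/ 2 < n -> holds a cf ->
  synced (While 5 layer_code :: k) m (2 ^ j %/ 2) 0 cf ->
  exists cf', [/\ par_run test (j * ((n %/ p).+1 * 22 + 7)).+1 cf = Some cf',
    holds (cleans test n j a) cf' & synced k m 0 0 cf'].
Proof.
elim: j a cf => [|j IH] a cf hj ha hsync.
  apply: (@par_private _ _ _
    (fun i st => exists cnt c, ready k i m 0 0 cnt c st)) => // i.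
  have [cnt [c [w hw ->]]] := hsync i.
  eapply exec_while; [by [] | reflexivity | rewrite [X in Local X _]/=].
  by eexists; first reflexivity; exists cnt, c, w.
have e : 2 ^ j.+1 %/ 2 = 2 ^ j by rewrite expnS mulKn.
rewrite e in hj hsync.
have [|cf1 [e1 h1 s1]] := @par_layer m (2 ^ j) false a cf k _ ha hsync.
  by rewrite expn_gt0.
have [|cf2 [e2 h2 s2]] := IH _ cf1 _ h1 s1.
  exact: leq_ltn_trans (leq_div _ _) hj.
exists cf2; split=> //.
by rewrite mulSn -addnS (par_run_add _ e1).
Qed.

Definition at_stage k (cf : config g T) : Prop :=
  forall i : 'I_p, exists cnt, ready [:: While 8 stage_code] i (2 ^ k) 0 0 cnt
    (2 ^ k < n) (proc cf i).

(** One mirror layer and [k] half cleaners. The 6 steps are the stage test, two instructions before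
    the layers, the exit test of the layer loop and two instructions after it. *)
Definition stage_time k := k.+1 * ((n %/ p).+1 * 22 + 7) + 6.

Lemma par_stage k a (cf : config g T) :
  2 ^ k < n -> holds a cf -> at_stage k cf ->
  exists cf', [/\ par_run test (stage_time k) cf = Some cf',
    holds (cleans test n k (layer test n (2 ^ k) true a)) cf'
    & at_stage k.+1 cf'].
Proof.
move=> hk ha hst; have k0 : 0 < 2 ^ k by rewrite expn_gt0.
pose K := [:: Op (Arith Add 4 4 4); Op (Arith Lt 8 4 0); While 8 stage_code].
have [i|cf1 [e1 h1 s1]] := @par_private 3 cf a (fun i st => exists cnt c,
    ready (While 5 layer_code :: K) i (2 ^ k) (2 ^ k) (2 ^ k).-1 cnt c st) ha.
  have [cnt [w hw ->]] := hst i; rewrite hk.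
  eapply exec_while; [by [] | reflexivity | rewrite [X in Local X _]/= /regs].
  apply: exec_move; [by [] | by [] | by rewrite /=; lia | rewrite /=].
  arith (2 ^ k).-1.
  by eexists; first reflexivity; exists cnt, 1, w.
have [|cf2 [e2 h2 s2]] := @par_layer (2 ^ k) (2 ^ k) true a cf1 K _ h1 s1.
  by rewrite k0.
have [|cf3 [e3 h3 s3]] := @par_cleans _ _ _ _ _ _ h2 s2.
  exact: leq_ltn_trans (leq_div _ _) hk.
have [i|cf4 [e4 h4 s4]] := @par_private 2 cf3 _ (fun i st => exists cnt,
    ready [:: While 8 stage_code] i (2 ^ k.+1) 0 0 cnt (2 ^ k.+1 < n) st) h3.
  have [cnt [c [w hw ->]]] := s3 i; rewrite expnS /regs /K.
  arith (2 * 2 ^ k). arith (nat_of_bool (2 * 2 ^ k < n)).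
  by eexists; first reflexivity; exists cnt, w.
exists cf4; split=> //.
have -> : stage_time k = 3 + (((n %/ p).+1 * 22 + 7) +
    ((k * ((n %/ p).+1 * 22 + 7)).+1 + 2)).
  by rewrite /stage_time mulSn; lia.
by rewrite (par_run_add _ e1) (par_run_add _ e2) (par_run_add _ e3).
Qed.

Definition stages_time k := \sum_(j < k) stage_time j.

Lemma par_stages k a (cf : config g T) :
  (forall j, j < k -> 2 ^ j < n) -> holds a cf -> at_stage 0 cf ->
  exists cf', [/\ par_run test (stages_time k) cf = Some cf',
    holds (network test n k a) cf' & at_stage k cf'].
Proof.
move=> hk ha hst; elim: k hk => [|k IH] hk.
  by exists cf; split; rewrite // /stages_time big_ord0.
have [j hj|cf1 [e1 h1 s1]] := IH; first by apply: hk; exact: ltnW.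
have [cf2 [e2 h2 s2]] := par_stage (hk k (ltnSn k)) h1 s1.
exists cf2; split=> //.
by rewrite /stages_time big_ord_recr /= (par_run_add _ e1).
Qed.

(** The stage loop stops at the first [k] with [n <= 2 ^ k], which is [up_log 2 n]. The 7 steps are
    the six initial instructions and the last loop test. *)
Lemma par_sorter a (cf : config g T) : holds a cf ->
  (forall i, proc cf i = Local sorter (fun=> Num 0)) ->
  exists cf', [/\ par_run test (7 + stages_time (up_log 2 n)) cf = Some cf',
    holds (network test n (up_log 2 n) a) cf' & halted cf'].
Proof.
move=> ha hinit; have n0 : 0 < n by exact: leq_trans pn.
have [i|cf1 [e1 h1 s1]] := @par_private 6 cf a (fun i st => exists cnt,
    ready [:: While 8 stage_code] i 1 0 0 cnt (1 < n) st) ha.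
  have hid := ltn_ord i; rewrite hinit.
  have -> : (fun=> Num 0) = bank (nseq 15 (@Num T 0)).
    by apply: functional_extensionality => x; rewrite /bank nth_nseq if_same.
  rewrite /sorter /=.
  do 5 (apply: exec_set; [by [] | by rewrite /=; lia | rewrite /=]).
  arith (nat_of_bool (1 < n)).
  by eexists; first reflexivity; exists 0, (nseq 6 (Num 0)).
have [j|cf2 [e2 h2 s2]] := @par_stages (up_log 2 n) a cf1 _ h1 s1.
  move=> hj; rewrite ltnNge; apply: contraL hj => hj.
  by rewrite -leqNgt up_log_min.
have [i|cf3 [e3 h3 s3]] := @par_private 1 cf2 _
    (fun i st => control st = [::]) h2.
  have [cnt [w hw ->]] := s2 i.
  rewrite ltnNge up_logP //.
  eapply exec_while; [by [] | reflexivity | rewrite [X in Local X _]/=].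
  by eexists; first reflexivity.
exists cf3; split=> //.
have -> : 7 + stages_time (up_log 2 n) = 6 + (stages_time (up_log 2 n) + 1).
  by lia.
by rewrite (par_run_add _ e1) (par_run_add _ e2).
Qed.

End Sorter.

(** * Bounds on the span and on the word size *)

(** Since [p * (n %/ p).+1 <= 2 * n], a layer contributes at most [44 * n + 7 * n], and a stage at
    most [57 * n * B]. There are at most [B] stages, and the remaining [7 * p] raises the constant
    to 64. *)
Lemma stages_time_le n p : 0 < p <= n ->
  p * (7 + stages_time n p (up_log 2 n)) <= 64 * n * (trunc_log 2 n).+1 ^ 2.
Proof.
move=> /andP[p0 pn]; set B := (trunc_log 2 n).+1.
have LB : up_log 2 n <= B by apply: up_log_min => //; exact/ltnW/trunc_log_ltn.
have hJ : p * (n %/ p).+1 <= n + n.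
  by rewrite mulnS mulnC addnC leq_add // leq_divM.
have hs : p * stages_time n p (up_log 2 n) <= B * (57 * n * B).
  rewrite /stages_time big_distrr /=.
  apply: leq_trans (_ : \sum_(j < up_log 2 n) 57 * n * B <= _); last first.
    by rewrite sum_nat_const card_ord leq_mul2r LB orbT.
  apply: leq_sum => j _; rewrite /stage_time.
  have jB : j.+1 <= B by exact: leq_trans (ltn_ord j) LB.
  rewrite mulnDr mulnCA.
  rewrite (_ : 57 * n * B = B * (51 * n) + B * (6 * n)); last by lia.
  apply: leq_add; first by apply: leq_mul; rewrite // mulnDr mulnA; lia.
  by rewrite mulnC (leq_trans (leq_mul (leqnn 6) pn)) // leq_pmull.
rewrite mulnDr (_ : 64 * n * B ^ 2 = 7 * n * (B * B) + B * (57 * n * B)).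
  apply: leq_add => //; rewrite mulnC (leq_trans (leq_mul (leqnn 7) pn)) //.
  by rewrite leq_pmulr.
by rewrite -mulnn; lia.
Qed.

(** With [B] at least 2 and at least [n], the fourth power splits as [B ^ 3 * B], which dominates
    [8 * n]. *)
Lemma word_bound_ge n : 0 < n -> 8 * n <= word_bound 4 n.
Proof.
move=> n0; rewrite /word_bound [4 * _]mulnC expnM.
set B := 2 ^ (trunc_log 2 n).+1.
have nB : n <= B by exact/ltnW/trunc_log_ltn.
have B2 : 2 <= B by rewrite /B expnS leq_pmulr // expn_gt0.
by rewrite (expnD B 3 1 : B ^ 4 = _) leq_mul // (leq_exp2r 2 B (erefl : 0 < 3)).
Qed.

(** * From separated outputs to packing and partition *)

Definition separated (T : Type) (low : T -> bool) (b : seq T) : Prop :=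
  exists l r, [/\ b = l ++ r, all low l & all (predC low) r].

(** As [n <= 2 ^ k], block 0 contains the whole array. *)
Lemma network_separated (T : Type) (test : T -> T -> bool) n k low a :
  respects test low -> n <= 2 ^ k ->
  separated low (mkseq (network test n k a) n).
Proof.
move=> lowP hn; have [u hu] := network_descending n lowP k 0 a.
have {}hu x : x < n -> low (network test n k a x) = (x < u).
  by move=> hx; rewrite -hu ?(leq_trans hx) // /block /view add0n hx.
pose v := minn u n; have vn : v <= n by exact: geq_minr.
exists (mkseq (network test n k a) v).
exists (map (network test n k a) (iota v (n - v))).
split; first by rewrite -map_cat -iotaD subnKC.
- rewrite all_map; apply/allP => x; rewrite mem_iota add0n leq_min /=.
  by move=> /andP[xu xn]; rewrite hu.
- rewrite all_map; apply/allP => x; rewrite mem_iota subnKC //= => /andP[vx xn].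
  by rewrite hu //; move: vx; rewrite /v; lia.
Qed.

(** The assumption on [ok] is the interface with both problems: the output is a permutation,
    separated by every compatible predicate. *)
Lemma sorter_solves (T : eqType) (test : T -> T -> bool) (a : seq T)
    (ok : seq T -> Prop) n p W :
  size a = n -> 0 < p <= n -> 8 * n <= W ->
  (forall b, perm_eq b a ->
     (forall low, respects test low -> separated low b) -> ok b) ->
  solves sorter (Params n p n 15 W) (Instance test a ok)
    (7 + stages_time n p (up_log 2 n)).
Proof.
move=> sa /andP[p0 pn] hW hok; have n0 : 0 < n by exact: leq_trans pn.
have [x0 _] : exists x0 : T, x0 \in a.
  case: a sa {hok} => [|x a _]; first by move: n0 => /[swap] <-.
  by exists x; rewrite mem_head.
have [||cf [e h halt]] := par_sorter test p0 pn hW (a := nth x0 a)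
    (cf := init (Params n p n 15 W) sorter a).
- by move=> x xn /=; rewrite (nth_map x0) // sa.
- by [].
exists cf; split=> //.
exists (mkseq (network test n (up_log 2 n) (nth x0 a)) n); split.
- apply: hok => [|low lowP].
    by rewrite -[X in perm_eq _ X](mkseq_nth x0) sa perm_network.
  by apply: network_separated; rewrite // up_logP.
- by rewrite -map_comp; apply/eq_in_map => x; rewrite mem_iota => /andP[_ /h].
Qed.

Lemma sorter_sync_strict_pip (P : problem) :
  (forall I n p W, P I -> size (input I) = n -> 0 < p <= n -> 8 * n <= W ->
     solves sorter (Params n p n 15 W) I (7 + stages_time n p (up_log 2 n))) ->
  sync_strict_pip P sorter.
Proof.
(* The factor 4 is that of [word_bound_ge]; the shared memory is the input alone, and 15 counts
   registers 0 to 14. *)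
move=> hP; exists 4, (fun n _ => n), (fun _ _ => 15).
exists (fun n p => 7 + stages_time n p (up_log 2 n)); split=> //.
- move=> n p I PI sI hp; apply: hP => //; apply: word_bound_ge.
  by case/andP: hp; exact: leq_trans.
- by exists 15.
- by exists 64, 2 => n p; exact: stages_time_le.
- by exists 15.
Qed.

(** The prefix [l2] of elements at most [q] contains [q], so it is longer than the prefix [l] of
    elements below [q]. The element [y] just after [l] is thus both at most and at least [q], hence
    equal to it. *)
Lemma partitioned_of_separated d (T : orderType d) (q : T) (a b : seq T) :
  perm_eq b a -> q \in a -> separated (fun x => x < q)%O b ->
  separated (fun x => x <= q)%O b -> partitioned q a b.
Proof.
move=> ba qa [l [r [eb hl hr]]] [l2 [r2 [eb2 hl2 hr2]]]; split=> //.
have qb : q \in b by rewrite (perm_mem ba).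
have ql2 : q \in l2.
  move: qb; rewrite eb2 mem_cat => /orP[//|/(allP hr2)].
  by rewrite /= Order.POrderTheory.lexx.
have : q \in r.
  move: qb; rewrite eb mem_cat => /orP[/(allP hl)|//].
  by rewrite Order.POrderTheory.ltxx.
case: r eb hr => // y r eb /= /andP[hy hr] _.
have hlt : size l < size l2.
  rewrite ltnNge; apply/negP => hs.
  have e : l2 = take (size l2) l.
    by rewrite -(@takel_cat (size l2) T l (y :: r)) // -eb eb2 take_size_cat.
  have := allP hl q; rewrite Order.POrderTheory.ltxx => h.
  by have /h : q \in l by apply: (@mem_take (size l2)); rewrite -e.
have yl2 : y \in l2.
  have -> : y = nth y b (size l) by rewrite eb nth_cat ltnn subnn.
  by rewrite eb2 nth_cat hlt mem_nth.
have yq : y = q.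
  apply/eqP; rewrite Order.POrderTheory.eq_le (allP hl2 _ yl2).
  by rewrite Order.TotalTheory.leNgt.
exists l, r; rewrite -{1}yq; split=> //; apply: sub_all hr => x /=.
by rewrite -Order.TotalTheory.leNgt.
Qed.

Theorem corollary18 :
  (exists prog : program, sync_strict_pip packing prog) /\
  (exists prog : program, sync_strict_pip pivot_partition prog).
Proof.
split; exists sorter; apply: sorter_sync_strict_pip.
- move=> _ n p W [T label a] sa hp hW; apply: sorter_solves => // b ba hb.
  split=> //; have [|l [r [-> hl hr]]] := hb label.
    by move=> x y; case: (label y); case: (label x).
  by exists l, r.
- move=> _ n p W [d T a q] sa hp hW; apply: sorter_solves => // b ba hb.
  apply: partitioned_of_separated => //; first by rewrite mem_rcons mem_head.
  (* An exchange means [y < x], so [x] low forces [y] low; no exchange means [x <= y] and the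
     converse implication. *)
  + apply: hb => x y; case: ifP => [yx xq|].
      exact: Order.POrderTheory.lt_trans xq.
    move=> /negbT; rewrite -Order.TotalTheory.leNgt.
    exact: Order.POrderTheory.le_lt_trans.
  + apply: hb => x y; case: ifP => [yx xq|].
      exact/Order.POrderTheory.ltW/(Order.POrderTheory.lt_le_trans yx).
    move=> /negbT; rewrite -Order.TotalTheory.leNgt.
    exact: Order.POrderTheory.le_trans.
Qed.
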